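(* Let $F>0$, let $N\ge 2$ be an integer, $\varepsilon=1/N$, and let $y_F$ be the straight chain with nearest neighbor interatomic spacing $F\varepsilon$. Then $$\inf_{u\in\mathcal U\setminus\{0\}}\frac{\delta^2\mathcal E^{\mathrm{CB}}(y_F)[u,u]}{\|u'\|_{\ell^2_\varepsilon}^2}=\min\left\{\phi''(F)+4\,\phi''(2F),\ \frac{\phi'(F)+2\,\phi'(2F)}{F}\right\}.$$
   Context: Let $\varepsilon=1/N$. $\mathcal Y$ is the set of sequences $y=\{y_\ell\}_{\ell\in\mathbb Z}$, $y_\ell\in\mathbb R^2$, with $y_{\ell+N}=y_\ell+(y_N-y_0)$ for all $\ell$. $\mathcal U$ is the set of $N$-periodic sequences $u=\{u_\ell\}_{\ell\in\mathbb Z}$ in $\mathbb R^2$ with $\sum_{\ell=1}^N u_\ell=0$. Backward difference: $y'_\ell=(y_\ell-y_{\ell-1})/\varepsilon$. $\|\cdot\|$ is the Euclidean norm on $\mathbb R^2$ and $\|v\|_{\ell^2_\varepsilon}=\left(\varepsilon\sum_{\ell=1}^N\|v_\ell\|^2\right)^{1/2}$. The pair potential $\phi:(0,\infty)\to\mathbb R$ is twice continuously differentiable. The Cauchy--Born energy is $\mathcal E^{\mathrm{CB}}(y)=\varepsilon\sum_{\ell=1}^N[\phi(\|y'_\ell\|)+\phi(2\|y'_\ell\|)]$. The second variation is $\delta^2\mathcal E(y)[u,v]=\frac{\partial^2}{\partial s\,\partial t}\mathcal E(y+su+tv)\big|_{s=t=0}$. The straight chain is $(y_F)_\ell=(F\varepsilon\ell,0)$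 (up to translation along the line). *)

(* Defs.v *)
From HB Require Import structures.
From mathcomp Require Import all_boot all_order all_algebra.
From mathcomp Require Import all_classical all_reals all_analysis.
From mathcomp Require Import ring.

Set Implicit Arguments.
Unset Strict Implicit.
Unset Printing Implicit Defensive.

Import Order.TTheory GRing.Theory Num.Theory.
Import numFieldNormedType.Exports.

Local Open Scope ring_scope.
Local Open Scope classical_set_scope.

(* Sequences in R^2 indexed by Z are functions int -> 'rV[R]_2; coordinate 0
   is the direction of the chain. *)

Definition eps (R : realType) (N : nat) : R := N%:R^-1.

(* Euclidean norm; the library norm `|x| on 'rV[R]_2 is the sup norm. *)
Definition enorm (R : realType) (x : 'rV[R]_2) : R :=
  Num.sqrt (\sum_(i < 2) x 0 i ^+ 2).

Definition calY (R : realType) (N : nat) : set (int -> 'rV[R]_2) :=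
  [set y | forall l : int, y (l + N%:Z) = y l + (y N%:Z - y 0)].

Definition calU (R : realType) (N : nat) : set (int -> 'rV[R]_2) :=
  [set u | (forall l : int, u (l + N%:Z) = u l) /\
           \sum_(1 <= l < N.+1) u l%:Z = 0].

Definition bdiff (R : realType) (N : nat) (y : int -> 'rV[R]_2) :
    int -> 'rV[R]_2 :=
  fun l => (eps R N)^-1 *: (y l - y (l - 1)).

Definition l2norm (R : realType) (N : nat) (v : int -> 'rV[R]_2) : R :=
  Num.sqrt (eps R N * \sum_(1 <= l < N.+1) enorm (v l%:Z) ^+ 2).

(* Twice continuous differentiability on (0, +oo). A potential on (0, +oo) is
   represented by a total function; its values off (0, +oo) are irrelevant. *)
Definition C2_pos (R : realType) (phi : R -> R) : Prop :=
  forall r : R, 0 < r ->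
    [/\ derivable phi r 1, derivable (derive1 phi) r 1 &
        {for r, continuous (derive1n 2 phi)}].

Definition ECB (R : realType) (phi : R -> R) (N : nat)
    (y : int -> 'rV[R]_2) : R :=
  eps R N * \sum_(1 <= l < N.+1)
    (phi (enorm (bdiff N y l%:Z)) + phi (2 * enorm (bdiff N y l%:Z))).

Definition second_variation (R : realType) (E : (int -> 'rV[R]_2) -> R)
    (y u v : int -> 'rV[R]_2) : R :=
  derive1 (fun s : R =>
    derive1 (fun t : R => E (fun l => y l + s *: u l + t *: v l)) 0) 0.

(* [a] is the arbitrary translation along the line of the chain. *)
Definition straight_chain (R : realType) (N : nat) (F a : R) :
    int -> 'rV[R]_2 :=
  fun l => \row_(i < 2) (if i == 0 then a + F * eps R N * l%:~R else 0).

(* The configurations at which [ECB] is evaluated in the second variation at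
   the straight chain lie in [calY]. *)
Lemma straight_chain_calY (R : realType) (N : nat) (F a : R) :
  straight_chain N F a \in calY N.
Proof.
apply/mem_set => l; apply/rowP => i; rewrite !mxE.
case: ifP => _; last by rewrite subrr addr0.
by rewrite rmorphD /=; ring.
Qed.

Lemma calY_perturb (R : realType) (N : nat) (y u v : int -> 'rV[R]_2)
    (s t : R) :
  calY N y -> calU N u -> calU N v ->
  calY N (fun l => y l + s *: u l + t *: v l).
Proof.
move=> yY [uN _] [vN _] l; rewrite yY uN vN.
have -> : u N%:Z = u 0 by rewrite -[N%:Z]add0r uN.
have -> : v N%:Z = v 0 by rewrite -[N%:Z]add0r vN.
by rewrite !opprD !addrA; apply/rowP => i; rewrite !mxE; ring.
Qed.

(* Main.v *)
Require Import Defs.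
From HB Require Import structures.
From mathcomp Require Import all_boot all_order all_algebra.
From mathcomp Require Import all_classical all_reals all_analysis.
From mathcomp Require Import ring.

Import Order.TTheory GRing.Theory Num.Theory.
Import numFieldNormedType.Exports.

Local Open Scope ring_scope.
Local Open Scope classical_set_scope.

(** Along a perturbation with strain [u'_l = (p, q)], a bond of the straight
    chain has length [sqrt ((F + x p)^2 + (x q)^2)], whose first two
    derivatives at [x = 0] are [p] and [q^2 / F]. Hence the second variation decouples into
    [eps * sum_l (A p_l^2 + B q_l^2)] with [A = phi''(F) + 4 phi''(2F)] and
    [B = (phi'(F) + 2 phi'(2F)) / F], and the quotient is a weighted mean of
    [A] and [B]; a purely longitudinal, resp. purely transversal, displacement
    realizes [A], resp. [B]. *)

(** * Second variation along a single direction *)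

Lemma derive1_shift (R : realType) (f : R -> R) (s : R) :
  derive1 (fun t => f (s + t)) 0 = derive1 f s.
Proof.
rewrite /derive1 addr0.
have -> // : (fun h => h^-1 *: (f (s + (h + 0)) - f s)) =
             (fun h => h^-1 *: (f (h + s) - f s)).
by apply/funext => h; rewrite addr0 (addrC s).
Qed.

(** When both directions equal [u], the perturbed energy is [G (s + t)]: the inner derivative in [t]
    at 0 is the derivative of [G] at [s], so the mixed derivative becomes an ordinary second
    derivative. *)
Lemma second_variation_diag (R : realType) (E : (int -> 'rV[R]_2) -> R)
    (y u : int -> 'rV[R]_2) (G : R -> R) :
  (forall x, E (fun l => y l + x *: u l) = G x) ->
  second_variation E y u u = derive1 (derive1 G) 0.
Proof.
move=> EG; rewrite /second_variation.
have -> // : (fun s => derive1 (fun t => E (fun l => y l + s *: u l + t *: u l)) 0)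
             = derive1 G.
apply/funext => s; rewrite -[RHS]derive1_shift.
have -> // : (fun t => E (fun l => y l + s *: u l + t *: u l))
             = (fun t => G (s + t)).
apply/funext => t; rewrite -EG; congr E.
by apply/funext => l; rewrite scalerDl addrA.
Qed.

Lemma sqr_enorm (R : realType) (x : 'rV[R]_2) :
  enorm x ^+ 2 = x 0 0 ^+ 2 + x 0 1 ^+ 2.
Proof.
rewrite sqr_sqrtr ?sumr_ge0// => [|i _]; last exact: sqr_ge0.
rewrite !big_ord_recl big_ord0 addr0; congr (_ + x _ _ ^+ 2).
exact: val_inj.
Qed.

Lemma sqr_l2norm (R : realType) (N : nat) (v : int -> 'rV[R]_2) :
  l2norm N v ^+ 2 = eps R N *
    (\sum_(1 <= l < N.+1) v l%:Z 0 0 ^+ 2 +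
     \sum_(1 <= l < N.+1) v l%:Z 0 1 ^+ 2).
Proof.
rewrite sqr_sqrtr; last first.
  by rewrite mulr_ge0 ?invr_ge0 ?ler0n ?sumr_ge0// => i _; exact: sqr_ge0.
by rewrite -big_split/=; under eq_bigr do rewrite sqr_enorm.
Qed.

(** * Calculus of one stretched bond *)

Section Stretch.
Context {R : realType}.
Implicit Types (F p q r s : R) (phi : R -> R).

Definition stretch F p q : R -> R :=
  fun s => Num.sqrt ((F + s * p) ^+ 2 + (s * q) ^+ 2).

Lemma stretch0 F p q : 0 < F -> stretch F p q 0 = F.
Proof.
by move=> F0; rewrite /stretch !mul0r addr0 expr0n addr0 sqrtr_sqr gtr0_norm.
Qed.

(** The square root and [phi] are differentiated only at positive arguments. A whole neighborhood of
    0 is needed because the first derivative is itself differentiated at 0. *)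
Lemma near_sqr_stretch_gt0 F p q : 0 < F ->
  \forall s \near (0 : R), 0 < (F + s * p) ^+ 2 + (s * q) ^+ 2.
Proof.
move=> F0.
have c : (fun s : R => F + s * p) @ (0 : R) --> F + 0 * p.
  apply: cvgD; first exact: cvg_cst.
  by apply: cvgMl; exact: cvg_id.
near=> s; apply: ltr_wpDr; first exact: sqr_ge0.
apply: exprn_gt0; near: s; apply: (cvgr_gt _ c).
by rewrite mul0r addr0.
Unshelve. all: by end_near. Qed.

Lemma is_derive_affine (b p s : R) :
  is_derive s 1 (fun x : R => b + x * p) p.
Proof.
have := is_deriveD (is_derive_cst b s 1)
  (is_deriveM (is_derive_id s 1) (is_derive_cst p s 1)).
by rewrite /= scaler0 !add0r -[p *: 1]/(p * 1) mulr1.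
Qed.

Lemma is_derive_stretch F p q s : 0 < (F + s * p) ^+ 2 + (s * q) ^+ 2 ->
  is_derive s 1 (stretch F p q)
    (((F + s * p) * p + s * q ^+ 2) / stretch F p q s).
Proof.
move=> gt0.
(* The summand 0 in [g] lets [is_derive_affine] serve for both components. *)
pose f := fun x : R => F + x * p; pose g := fun x : R => 0 + x * q.
have df : is_derive s 1 f p by exact: is_derive_affine.
have dg : is_derive s 1 g q by exact: is_derive_affine.
have fgE : (fun x => (F + x * p) ^+ 2 + (x * q) ^+ 2) = f ^+ 2 + g ^+ 2.
  by apply/funext => x; rewrite !fctE /f /g add0r.
have /= := is_deriveD (is_deriveX 2 df) (is_deriveX 2 dg).
rewrite -fgE => dh.
have := @is_derive1_comp _ Num.sqrt
  (fun x => (F + x * p) ^+ 2 + (x * q) ^+ 2) _ _ _ (is_derive1_sqrt gt0) dh.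
move=> /is_derive_eq; apply.
rewrite /stretch /f /g /= add0r.
have r0 : Num.sqrt ((F + s * p) ^+ 2 + (s * q) ^+ 2) != 0.
  by rewrite gt_eqF// sqrtr_gt0.
rewrite -![_ *: _]/(_ * _).
set r := Num.sqrt _ in r0 *; field; exact: r0.
Qed.

Definition bond_energy phi r := phi r + phi (2 * r).

(** This is the derivative of [bond_energy], without the minus sign of a physical force. *)
Definition bond_force phi r := derive1 phi r + 2 * derive1 phi (2 * r).

Definition bond_stiffness phi r :=
  derive1n 2 phi r + 4 * derive1n 2 phi (2 * r).

Lemma is_derive_double (f : R -> R) r : derivable f (2 * r) 1 ->
  is_derive r 1 (fun x => f (2 * x)) (2 * derive1 f (2 * r)).
Proof.
move=> df; have d2 : is_derive r 1 (fun x : R => 2 * x) 2.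
  have -> : (fun x : R => 2 * x) = (fun x => 0 + x * 2).
    by apply/funext => x; rewrite add0r mulrC.
  exact: is_derive_affine.
have := @is_derive1_comp _ f _ _ _ _ (derivableP df) d2.
by rewrite -derive1E mulrC.
Qed.

Lemma is_derive_bond_energy phi r : C2_pos phi -> 0 < r ->
  is_derive r 1 (bond_energy phi) (bond_force phi r).
Proof.
move=> phiC r0; have [d _ _] := phiC r r0.
have /phiC[d2 _ _] : 0 < 2 * r by rewrite mulr_gt0.
have := is_deriveD (derivableP d) (is_derive_double _ _ d2).
by rewrite -derive1E.
Qed.

Lemma is_derive_bond_force phi r : C2_pos phi -> 0 < r ->
  is_derive r 1 (bond_force phi) (bond_stiffness phi r).
Proof.
move=> phiC r0; have [_ d _] := phiC r r0.
have /phiC[_ d2 _] : 0 < 2 * r by rewrite mulr_gt0.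
have := is_deriveD (derivableP d) (is_deriveZ 2 (is_derive_double _ _ d2)).
move=> /is_derive_eq; apply.
rewrite -derive1E -[_ *: _]/(_ * _) mulrA /bond_stiffness.
by rewrite -natrM.
Qed.

Definition stretch_force phi F p q : R -> R :=
  fun s => bond_force phi (stretch F p q s) *
           (((F + s * p) * p + s * q ^+ 2) / stretch F p q s).

Lemma is_derive_bond_stretch phi F p q s : C2_pos phi ->
  0 < (F + s * p) ^+ 2 + (s * q) ^+ 2 ->
  is_derive s 1 (bond_energy phi \o stretch F p q) (stretch_force phi F p q s).
Proof.
move=> phiC gt0; apply: is_derive1_comp; last exact: is_derive_stretch.
by apply: is_derive_bond_energy => //; rewrite sqrtr_gt0.
Qed.

(** At 0 the length is [F] with slope [p], so the force factor contributes stiffness times [p ^+ 2].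
    The slope factor has derivative [((p ^+ 2 + q ^+ 2) * F - F * p * p) / F ^+ 2 = q ^+ 2 / F],
    which the force multiplies. *)
Lemma is_derive_stretch_force phi F p q : C2_pos phi -> 0 < F ->
  is_derive (0 : R) 1 (stretch_force phi F p q)
    (bond_stiffness phi F * p ^+ 2 + bond_force phi F / F * q ^+ 2).
Proof.
move=> phiC F0; have gt0 : 0 < (F + 0 * p) ^+ 2 + (0 * q) ^+ 2.
  by rewrite !mul0r addr0 expr0n addr0 exprn_gt0.
have ds := is_derive_stretch _ _ _ _ gt0.
have s0 := stretch0 F p q F0.
have Fn0 : F != 0 by rewrite gt_eqF.
have df : is_derive (stretch F p q 0) 1 (bond_force phi) (bond_stiffness phi F).
  by rewrite s0; exact: is_derive_bond_force.
have sn0 : stretch F p q 0 != 0 by rewrite s0.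
(* The numerator [(F + s * p) * p + s * q ^+ 2] is affine in [s], with slope [p ^+ 2 + q ^+ 2]. *)
have dn := is_derive_affine (F * p) (p ^+ 2 + q ^+ 2) 0.
have := is_deriveM (is_derive1_comp df ds) (is_deriveM dn (is_deriveV sn0 ds)).
have -> : (bond_force phi \o stretch F p q) *
   ((fun x => F * p + x * (p ^+ 2 + q ^+ 2)) *
    (fun x => (stretch F p q x)^-1)) = stretch_force phi F p q.
  by apply/funext => x; rewrite !fctE /stretch_force /=; congr (_ * (_ / _)); ring.
move=> /is_derive_eq; apply.
rewrite !fctE /= s0 -![_ *: _]/(_ * _) !mul0r !addr0.
by field.
Qed.
End Stretch.

(** * Second variation at the straight chain *)

(** The translation [a] cancels in differences, and the straight chain has constant strain
    [(F, 0)]. *)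
Lemma enorm_bdiff_straight (R : realType) (N : nat) (F a x : R)
    (u : int -> 'rV[R]_2) (l : int) : (0 < N)%N ->
  enorm (bdiff N (fun l => straight_chain N F a l + x *: u l) l) =
  stretch F (bdiff N u l 0 0) (bdiff N u l 0 1) x.
Proof.
move=> N0; have n0 : (N%:R : R) != 0 by rewrite pnatr_eq0 -lt0n.
rewrite /enorm /stretch !big_ord_recl big_ord0 addr0.
have -> : lift ord0 ord0 = 1 :> 'I_2 by exact: val_inj.
rewrite !mxE /= /eps rmorphB/=.
by congr (Num.sqrt (_ ^+ 2 + _ ^+ 2)); field.
Qed.

Lemma second_variation_straight (R : realType) (phi : R -> R) (F a : R)
    (N : nat) (u : int -> 'rV[R]_2) : C2_pos phi -> 0 < F -> (0 < N)%N ->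
  second_variation (ECB phi N) (straight_chain N F a) u u =
  eps R N *
    (bond_stiffness phi F * \sum_(1 <= l < N.+1) bdiff N u l%:Z 0 0 ^+ 2 +
     bond_force phi F / F * \sum_(1 <= l < N.+1) bdiff N u l%:Z 0 1 ^+ 2).
Proof.
move=> phiC F0 N0.
pose p (i : 'I_N) := bdiff N u i.+1%:Z 0 0.
pose q (i : 'I_N) := bdiff N u i.+1%:Z 0 1.
pose G := eps R N *: \sum_(i < N) (bond_energy phi \o stretch F (p i) (q i)).
pose G' := eps R N *: \sum_(i < N) stretch_force phi F (p i) (q i).
rewrite (@second_variation_diag _ _ _ _ G); last first.
  move=> x; rewrite /ECB /G big_add1 big_mkord fctE fct_sumE.
  congr (_ * _); apply: eq_bigr => i _.
  by rewrite enorm_bdiff_straight.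
(* [G'] need only be the derivative of [G] near 0: there no bond collapses, and finitely many bonds
   share one such neighborhood. This local agreement suffices to differentiate once more at 0. *)
have nearG : \forall s \near (0 : R), G' s = derive1 G s.
  have /filter_forall : forall i : 'I_N,
      \forall s \near (0 : R), 0 < (F + s * p i) ^+ 2 + (s * q i) ^+ 2.
    by move=> i; exact: near_sqr_stretch_gt0.
  apply: filterS => s gt0; rewrite derive1E; symmetry; apply: derive_val.
  have := is_deriveZ (eps R N) (is_derive_sum (fun i =>
    is_derive_bond_stretch phi F (p i) (q i) s phiC (gt0 i))).
  by move=> /is_derive_eq; apply; rewrite /G' fctE fct_sumE.
rewrite derive1E; apply: derive_val; apply: (near_eq_is_derive nearG).
have := is_deriveZ (eps R N) (is_derive_sum (fun i =>
  is_derive_stretch_force phi F (p i) (q i) phiC F0)).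
move=> /is_derive_eq; apply.
by rewrite big_split/= -!mulr_sumr !big_add1 !big_mkord.
Qed.

(** * Positivity of the denominator, and test displacements *)

(** If the sum of squares vanished, [u] would be constant over one period; zero mean makes that
    constant 0, and periodicity spreads it to all of Z. *)
Lemma calU_bdiff_gt0 (R : realType) (N : nat) (u : int -> 'rV[R]_2) :
  (0 < N)%N -> calU N u -> u <> (fun=> 0) ->
  0 < \sum_(1 <= l < N.+1) bdiff N u l%:Z 0 0 ^+ 2 +
      \sum_(1 <= l < N.+1) bdiff N u l%:Z 0 1 ^+ 2.
Proof.
move=> N0 [uN usum] unz.
have n0 : (N%:R : R) != 0 by rewrite pnatr_eq0 -lt0n.
rewrite -big_split/= lt_neqAle eq_sym sumr_ge0 ?andbT; last first.
  by move=> i _; rewrite addr_ge0 ?sqr_ge0.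
apply/negP; rewrite psumr_eq0; last by move=> i _; rewrite addr_ge0 ?sqr_ge0.
move/allP => /= H; apply: unz.
have step (l : nat) : (l < N)%N -> u l.+1%:Z = u l%:Z.
  move=> lN; have := H l.+1; rewrite mem_index_iota /= ltnS lN => /(_ isT).
  rewrite paddr_eq0 ?sqr_ge0// !sqrf_eq0 => /andP[/eqP e0 /eqP e1].
  have : bdiff N u l.+1%:Z = 0.
    apply/rowP => -[[|[|k]] // i]; rewrite [RHS]mxE.
    - by rewrite -[RHS]e0; congr (bdiff _ _ _ _ _); exact: val_inj.
    - by rewrite -[RHS]e1; congr (bdiff _ _ _ _ _); exact: val_inj.
  move/eqP; rewrite scaler_eq0 /eps invrK (negbTE n0)/= subr_eq0 => /eqP ->.
  by congr u; rewrite intS addrC addKr.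
have cst_u (l : nat) : (l <= N)%N -> u l%:Z = u 0.
  by elim: l => // l IH lN; rewrite step// IH// ltnW.
have u0 : u 0 = 0.
  move: usum; rewrite (eq_big_nat _ _ (F2 := fun=> u 0)).
    rewrite big_const_nat subn1 /= iter_addr_0 -scaler_nat => /eqP.
    by rewrite scaler_eq0 (negbTE n0) => /eqP.
  by move=> l /andP[_]; rewrite ltnS => /cst_u.
have uMn (k : nat) l : u (l + (k * N)%N%:Z) = u l.
  elim: k l => [|k IH] l; first by rewrite mul0n addr0.
  by rewrite mulSn PoszD addrA IH uN.
have uMz (k : int) l : u (l + k * N%:Z) = u l.
  case: k => k; first by rewrite -PoszM uMn.
  by rewrite -(uMn k.+1) NegzE mulNr -PoszM addrNK.
(* Division by [N] moves [l] to its remainder, which lies in the range covered by [cst_u]. *)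
apply/funext => l; rewrite (divz_eq l N) addrC uMz.
have Nz : N%:Z != 0 by rewrite -lt0n.
have := modz_ge0 l Nz; have := ltz_mod l Nz.
by case: (modz l N) => // m; rewrite ltz_nat => mN _; rewrite cst_u// ltnW.
Qed.

(* The difference of a periodic sequence (the indicator of [N Z]) telescopes
   over a period, hence has mean zero. *)
Definition dipole (R : realType) (N : nat) (j : 'I_2) : int -> 'rV[R]_2 :=
  fun l => ((N %| l)%Z%:R - (N %| l - 1)%Z%:R) *: delta_mx 0 j.

Lemma dipole_calU (R : realType) (N : nat) (j : 'I_2) : calU N (dipole R N j).
Proof.
split=> [l|].
  have dvd_period k : (N %| k + N%:Z)%Z = (N %| k)%Z by rewrite rpredDr ?dvdzz.
  by rewrite /dipole addrAC !dvd_period.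
rewrite /dipole -scaler_suml big_add1 /=.
under eq_bigr => i _ do rewrite [X in X - 1]intS [1 + _]addrC addrK.
rewrite (telescope_sumr (fun i : nat => (N %| i%:Z)%Z%:R)) //.
by rewrite dvdzz dvdz0 subrr scale0r.
Qed.

(** For [N >= 2], [N] divides 0 but not -1, so the value at 0 is the unit vector along [j]; for
    [N = 1] the dipole would vanish. *)
Lemma dipole_neq0 (R : realType) (N : nat) (j : 'I_2) : (2 <= N)%N ->
  dipole R N j <> (fun=> 0).
Proof.
move=> N2 /(congr1 (fun u : int -> 'rV[R]_2 => u 0 0 j)); rewrite !mxE !eqxx /=.
have -> : (N %| 0 - 1)%Z = false by rewrite dvdzE dvdn1 gtn_eqF.
rewrite dvdz0 subr0 mulr1 => /eqP.
by rewrite oner_eq0.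
Qed.

Lemma bdiff_dipole (R : realType) (N : nat) (j k : 'I_2) (l : int) : k != j ->
  bdiff N (dipole R N j) l 0 k = 0.
Proof. by move=> kj; rewrite !mxE (negbTE kj) /= !mulr0 subrr mulr0. Qed.

(** * The infimum of the quotient *)

Theorem theorem4p3 (R : realType) (phi : R -> R) (F a : R) (N : nat) :
  C2_pos phi -> 0 < F -> (2 <= N)%N ->
  ereal_inf [set (second_variation (ECB phi N) (straight_chain N F a) u u
                    / l2norm N (bdiff N u) ^+ 2)%:E
            | u in calU N `\` [set (fun=> 0)]]
  = (Num.min (derive1n 2 phi F + 4 * derive1n 2 phi (2 * F))
             ((derive1 phi F + 2 * derive1 phi (2 * F)) / F))%:E.
Proof.
move=> phiC F0 N2; have N0 : (0 < N)%N by exact: ltnW.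
rewrite -/(bond_stiffness phi F) -/(bond_force phi F).
set A := bond_stiffness phi F; set B := bond_force phi F / F.
pose S k (u : int -> 'rV[R]_2) := \sum_(1 <= l < N.+1) bdiff N u l%:Z 0 k ^+ 2.
have quotE u : second_variation (ECB phi N) (straight_chain N F a) u u
    / l2norm N (bdiff N u) ^+ 2 = (A * S 0 u + B * S 1 u) / (S 0 u + S 1 u).
  rewrite second_variation_straight// sqr_l2norm -mulf_div divff ?mul1r//.
  by rewrite invr_eq0 pnatr_eq0 -lt0n.
have S_ge0 k u : 0 <= S k u by apply: sumr_ge0 => l _; exact: sqr_ge0.
have dipole_dom j : (calU N `\` [set (fun=> 0)]) (dipole R N j).
  by split; [exact: dipole_calU | exact: dipole_neq0].
have S_dipole j k : k != j -> S k (dipole R N j) = 0.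
  by move=> kj; rewrite /S big1// => l _; rewrite bdiff_dipole// expr0n.
apply/eqP; rewrite eq_le; apply/andP; split.
(* Upper bound: the dipole along the axis of the smaller coefficient has no strain in the other
   coordinate, so its quotient is exactly that coefficient. Positivity of the total then makes the
   remaining sum a nonzero divisor. *)
- rewrite /Num.min; case: ifP => _; apply: ereal_inf_lbound.
    exists (dipole R N 0) => //; rewrite quotE.
    have [uU /(calU_bdiff_gt0 _ _ _ N0 uU)] := dipole_dom 0.
    rewrite -!/(S _ _) (S_dipole 0 1)// mulr0 !addr0 => S0.
    by rewrite mulfK// gt_eqF.
  exists (dipole R N 1) => //; rewrite quotE.
  have [uU /(calU_bdiff_gt0 _ _ _ N0 uU)] := dipole_dom 1.
  rewrite -!/(S _ _) (S_dipole 1 0)// mulr0 !add0r => S0.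
  by rewrite mulfK// gt_eqF.
- apply: le_ereal_inf_tmp => _ [u [uU unz] <-]; rewrite quotE lee_fin.
  have := calU_bdiff_gt0 _ _ _ N0 uU unz; rewrite -!/(S _ _) => S_gt0.
  (* Lower bound: after clearing the positive denominator, compare term by term, since the minimum
     is at most [A] and at most [B] and the weights [S 0 u], [S 1 u] are nonnegative. *)
  rewrite ler_pdivlMr// mulrDr; apply: lerD; apply: ler_wpM2r => //.
    by rewrite ge_min lexx.
  by rewrite ge_min lexx orbT.
Qed.
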